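(* Let $U_*=\begin{pmatrix}1&0&0\\0&0&0\\0&0&0\end{pmatrix}$ and let $E$ be a $3$-plane (an affine subspace of dimension $3$) in $\mathbb{S}^3$ with $E\cap\mathbb{S}^3_+=\{U_*\}$. Let $B_1,B_2,B_3$ be an orthogonal basis of $E-U_*$, put $\phi(p)=U_*+p_1B_1+p_2B_2+p_3B_3$ for $p\in\mathbb{R}^3$, and for $x\in\mathbb{R}^3$ with $x_1\neq 0$ put $\psi(x)=\frac{1}{x_1}xx^T$. Suppose that $P_{\mathbb{S}^3_+}(\phi(p))$ has rank $1$, and let $\tilde p,x\in\mathbb{R}^3$ (with $x_1\ne0$) satisfy $P_{\mathbb{S}^3_+}(\phi(p))=\psi(x)$ and $P_E(\psi(x))=\phi(\tilde p)$. Then $$M(x)(\tilde p-p)+\nabla_x\tfrac12 d^2(\psi(x),E)=0,$$ where $M(x)=\big(\langle\partial_k\psi(x),B_i\rangle\big)_{k,i}\in\mathbb{R}^{3\times3}$ ($k$ the row index, $i$ the column index). Moreover, with $x_*=(1,0,0)$, if $\det M(x_* )\neq0$ and $p$ is sufficiently close to $(0,0,0)$, then $$\tilde p=p-M(x)^{-1}\nabla_x\tfrac12 d^2(\psi(x),E).$$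
   Context: $\mathbb{S}^3$ is the space of real symmetric $3\times3$ matrices with inner product $\langle A,B\rangle=\operatorname{tr}(A^TB)$ and Frobenius norm $\|\cdot\|$; $\mathbb{S}^3_+$ is the cone of positive semidefinite matrices. For a closed convex $C$, $P_C$ is the nearest-point projection onto $C$ and $d(A,C)=\inf_{X\in C}\|A-X\|$. $E-U_*=\{U-U_*:U\in E\}$; ''orthogonal basis'' means pairwise orthogonal, not necessarily normalized. $\partial_k$ denotes $\partial/\partial x_k$ (entrywise for matrix-valued functions), and $\nabla_x\frac12 d^2(\psi(x),E)$ is the gradient of the function $x\mapsto\frac12 d(\psi(x),E)^2$. Vectors of $\mathbb{R}^3$ are regarded as column vectors. *)

(* Defs.v *)
From HB Require Import structures.
From mathcomp Require Import all_boot all_order all_algebra.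
From mathcomp Require Import all_classical all_reals all_analysis.
Set Implicit Arguments.
Unset Strict Implicit.
Unset Printing Implicit Defensive.
Import Order.TTheory GRing.Theory Num.Theory.
Import numFieldNormedType.Exports.
Local Open Scope classical_set_scope.
Local Open Scope ring_scope.

Section FrobeniusGeometry.
Context {R : realType} {n : nat}.
Implicit Types (A X Y : 'M[R]_n) (C : set 'M[R]_n).

Definition symm_set : set 'M[R]_n := [set A | A \is symmetricmx].

Definition psd_cone : set 'M[R]_n :=
  [set A | A \is symmetricmx /\ forall v : 'cV[R]_n, 0 <= (v^T *m A *m v) 0 0].

Definition frob_inner A X : R := \tr (A^T *m X).

(* The norm that matrices carry in the library is the maximum norm; it induces
   the same topology, but distances and projections here are Euclidean. *)
Definition frob_norm A : R := Num.sqrt (frob_inner A A).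

Definition dist A C : R := inf [set frob_norm (A - X) | X in C].

Definition nearest_point C A X : Prop :=
  C X /\ forall Y, C Y -> frob_norm (A - X) <= frob_norm (A - Y).

(* A nearest point exists and is unique when C is nonempty, closed and convex;
   otherwise an arbitrary nearest point is chosen, or 0 if there is none. *)
Definition proj C A : 'M[R]_n := xget 0 [set X | nearest_point C A X].

Definition affine_subspace (d : nat) (E : set 'M[R]_n) : Prop :=
  exists (A0 : 'M[R]_n) (V : {vspace 'M[R]_n}),
    \dim V = d /\ E = [set A | A - A0 \in V].

Definition translate (E : set 'M[R]_n) (U : 'M[R]_n) : set 'M[R]_n :=
  [set X - U | X in E].

Definition orthogonal_basis (d : nat) (D : set 'M[R]_n)
    (B : d.-tuple 'M[R]_n) : Prop :=
  (exists V : {vspace 'M[R]_n}, D = [set A | A \in V] /\ basis_of V B) /\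
  (forall i j : 'I_d, i != j -> frob_inner (tnth B i) (tnth B j) = 0).

End FrobeniusGeometry.

Definition partial {R : realType} {n : nat} (k : 'I_n) (f : 'cV[R]_n -> R)
  (x : 'cV[R]_n) : R := 'D_(delta_mx k 0) f x.

Definition partial_mx {R : realType} {n m1 m2 : nat} (k : 'I_n)
    (F : 'cV[R]_n -> 'M[R]_(m1, m2)) (x : 'cV[R]_n) : 'M[R]_(m1, m2) :=
  \matrix_(i, j) partial k (fun y => F y i j) x.

Definition gradient {R : realType} {n : nat} (f : 'cV[R]_n -> R)
  (x : 'cV[R]_n) : 'cV[R]_n := \col_k partial k f x.

Section Plane.
Context {R : realType}.

Definition Ustar : 'M[R]_3 := delta_mx 0 0.

Definition phi (B : 3.-tuple 'M[R]_3) (p : 'cV[R]_3) : 'M[R]_3 :=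
  Ustar + \sum_(i < 3) p i 0 *: tnth B i.

Definition psi (x : 'cV[R]_3) : 'M[R]_3 := (x 0 0)^-1 *: (x *m x^T).

Definition Mmat (B : 3.-tuple 'M[R]_3) (x : 'cV[R]_3) : 'M[R]_3 :=
  \matrix_(k, i) frob_inner (partial_mx k psi x) (tnth B i).

Definition xstar : 'cV[R]_3 := delta_mx 0 0.

Definition half_sqdist (E : set 'M[R]_3) (x : 'cV[R]_3) : R :=
  2^-1 * dist (psi x) E ^+ 2.

Definition projection_step (E : set 'M[R]_3) (B : 3.-tuple 'M[R]_3)
    (p pt x : 'cV[R]_3) : Prop :=
  [/\ \rank (proj psd_cone (phi B p)) = 1%N,
      x 0 0 != 0,
      proj psd_cone (phi B p) = psi x &
      proj E (psi x) = phi B pt].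

End Plane.

(* Main.v *)
(* Both projections become first-order conditions. Since psi x is nearest to
   phi p among the matrices psi y with y_1 > 0, which are positive semidefinite,
   psi x - phi p is orthogonal to every partial derivative of psi at x. By
   Pythagoras the gradient of the half squared distance to E has components
   <d_k psi x, psi x - phi pt>. Adding <d_k psi x, phi pt - phi p>, which is the
   k-th component of M(x)(pt - p), gives <d_k psi x, psi x - phi p> = 0. For p
   near 0 the point x is near xstar, and det M is continuous there. *)
Require Import Defs.
From HB Require Import structures.
From mathcomp Require Import all_boot all_order all_algebra.
From mathcomp Require Import all_classical all_reals all_analysis.
From mathcomp Require Import ring lra.
Set Implicit Arguments.
Unset Strict Implicit.
Unset Printing Implicit Defensive.
Import Order.TTheory GRing.Theory Num.Theory.
Import numFieldNormedType.Exports.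
Local Open Scope classical_set_scope.
Local Open Scope ring_scope.

(** * The Frobenius inner product and nearest points *)

Section FrobeniusInner.
Context {R : realType} {n : nat}.
Implicit Types (A X Y : 'M[R]_n) (C : set 'M[R]_n).

Lemma frob_innerE A X : frob_inner A X = \sum_i \sum_j A i j * X i j.
Proof.
rewrite /frob_inner /mxtrace exchange_big /=; apply: eq_bigr => j _.
by rewrite mxE; apply: eq_bigr => i _; rewrite mxE.
Qed.

Lemma frob_innerC A X : frob_inner A X = frob_inner X A.
Proof. by rewrite /frob_inner -mxtrace_tr trmx_mul trmxK. Qed.

Lemma frob_innerDr A X Y : frob_inner A (X + Y) = frob_inner A X + frob_inner A Y.
Proof. by rewrite /frob_inner mulmxDr linearD. Qed.

Lemma frob_innerZr c A X : frob_inner A (c *: X) = c * frob_inner A X.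
Proof. by rewrite /frob_inner -scalemxAr linearZ. Qed.

Lemma frob_innerBr A X Y : frob_inner A (X - Y) = frob_inner A X - frob_inner A Y.
Proof. by rewrite /frob_inner mulmxBr linearB. Qed.

Lemma frob_innerDl A X Y : frob_inner (X + Y) A = frob_inner X A + frob_inner Y A.
Proof. by rewrite !(frob_innerC _ A) frob_innerDr. Qed.

Lemma frob_innerBl A X Y : frob_inner (X - Y) A = frob_inner X A - frob_inner Y A.
Proof. by rewrite !(frob_innerC _ A) frob_innerBr. Qed.

Lemma frob_inner_distC A X : frob_inner (A - X) (A - X) = frob_inner (X - A) (X - A).
Proof. by rewrite !frob_innerBl !frob_innerBr; ring. Qed.

Lemma frob_inner_sumr A (I : finType) (F : I -> 'M[R]_n) :
  frob_inner A (\sum_i F i) = \sum_i frob_inner A (F i).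
Proof. by rewrite /frob_inner mulmx_sumr raddf_sum. Qed.

Lemma frob_inner_ge0 A : 0 <= frob_inner A A.
Proof.
rewrite frob_innerE; apply: sumr_ge0 => i _; apply: sumr_ge0 => j _.
exact: sqr_ge0.
Qed.

Lemma le_frob_inner_entry A i j : A i j ^+ 2 <= frob_inner A A.
Proof.
rewrite frob_innerE (bigD1 i) //= (bigD1 j) //= -expr2 -addrA lerDl addr_ge0 //.
  by apply: sumr_ge0 => k _; apply: sqr_ge0.
by apply: sumr_ge0 => k _; apply: sumr_ge0 => l _; apply: sqr_ge0.
Qed.

Lemma frob_inner_eq0 A : (frob_inner A A == 0) = (A == 0).
Proof.
apply/eqP/eqP => [A0|->]; last by rewrite /frob_inner mulmx0 linear0.
apply/matrixP => i j; rewrite mxE; apply/eqP; rewrite -sqrf_eq0.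
by rewrite eq_le sqr_ge0 andbT -A0 le_frob_inner_entry.
Qed.

(** Nearest-point inequalities pass to squared norms, which are polynomial in the entries and so
    differentiable everywhere. *)
Lemma ler_frob_norm A X :
  (frob_norm A <= frob_norm X) = (frob_inner A A <= frob_inner X X).
Proof. by rewrite ler_sqrt ?frob_inner_ge0. Qed.

Lemma sqr_frob_norm A : frob_norm A ^+ 2 = frob_inner A A.
Proof. by rewrite sqr_sqrtr ?frob_inner_ge0. Qed.

(* 0 is the value of [proj] when no nearest point exists. *)
Lemma proj_nearest C A : Defs.proj C A != 0 -> nearest_point C A (Defs.proj C A).
Proof. by rewrite /Defs.proj; case: xgetP => [x _ //|_]; rewrite eqxx. Qed.

Lemma dist_nearest C A X : nearest_point C A X -> dist A C = frob_norm (A - X).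
Proof.
move=> [CX leX]; apply/le_anti/andP; split.
  by apply: ge_inf; [exists 0 => _ [Y _ <-]; apply: sqrtr_ge0 | exists X].
by apply: lb_le_inf; [exists (frob_norm (A - X)), X | move=> _ [Y CY <-]; apply: leX].
Qed.

End FrobeniusInner.

(** * Directional derivatives and Fermat's condition along a line *)

Section Derivatives.
Context {R : realType}.

Lemma is_derive_coord n (i : 'I_n) (x v : 'cV[R]_n) :
  is_derive x v (fun y : 'cV[R]_n => y i 0) (v i 0).
Proof.
have idx : derivable (@id 'cV[R]_n) x v by [].
apply: DeriveDef; first by move/derivable_mxP: idx; apply.
have := derive_mx idx.
by rewrite derive_val => /matrixP/(_ i 0) /[!mxE] <-.
Qed.

Lemma is_derive_inv (V : normedModType R) (f : V -> R) x v df :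
  f x != 0 -> is_derive x v f df ->
  is_derive x v (fun y => (f y)^-1) (- (f x) ^- 2 * df).
Proof.
move=> fx0 [fxv dfE]; apply: DeriveDef; first exact: derivableV.
by rewrite deriveV // dfE.
Qed.

Lemma is_derive_frob_inner (V : normedModType R) n (F G : V -> 'M[R]_n) x v (DF DG : 'M[R]_n) :
  (forall i j, is_derive x v (fun y => F y i j) (DF i j)) ->
  (forall i j, is_derive x v (fun y => G y i j) (DG i j)) ->
  is_derive x v (fun y => frob_inner (F y) (G y))
    (frob_inner DF (G x) + frob_inner (F x) DG).
Proof.
move=> dF dG.
have -> : (fun y => frob_inner (F y) (G y)) =
    \sum_i \sum_j ((fun y => F y i j) * (fun y => G y i j)).
  apply/funext => y; rewrite frob_innerE fct_sumE; apply: eq_bigr => i _.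
  by rewrite fct_sumE.
have dsum := is_derive_sum (fun i =>
  is_derive_sum (fun j => is_deriveM (dF i j) (dG i j))).
apply: is_derive_eq.
rewrite !frob_innerE -big_split; apply: eq_bigr => i _.
by rewrite -big_split; apply: eq_bigr => j _ /=; rewrite addrC [DF i j * _]mulrC.
Qed.

(** Fermat's theorem in one variable, applied to the restriction [g] of [f] to the line through [x]
    in direction [v]. *)
Lemma derive_line_min (V : normedModType R) (f : V -> R) x v e : 0 < e ->
  (forall t, t \in `]- e, e[%R -> derivable f (t *: v + x) v) ->
  (forall t, t \in `]- e, e[%R -> f x <= f (t *: v + x)) ->
  'D_v f x = 0.
Proof.
move=> e0 df fmin; pose g (t : R) : R := f (t *: v + x).
(* The difference quotients of [g] are those of [f] in direction [v], so both derivability and the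
   value of the derivative transfer. *)
have gE (t : R) : (fun h : R => h^-1 *: ((g \o shift t) (h *: (1 : R)) - g t)) =
    (fun h => h^-1 *: ((f \o shift (t *: v + x)) (h *: v) - f (t *: v + x))).
  apply/funext => h /=; rewrite /g; congr (_ *: (f _ - _)).
  by rewrite scalerDl addrA /GRing.scale /= mulr1.
have g0 : (0 : R) \in `]- e, e[%R by rewrite in_itv /= oppr_lt0 e0.
have le_e : - e <= e by rewrite (le_trans _ (ltW e0)) // oppr_le0 ltW.
have dg t : t \in `]- e, e[%R -> derivable g t 1.
  by move=> /df; rewrite /derivable gE.
have gmin t : t \in `]- e, e[%R -> g 0 <= g t.
  by move=> /fmin; rewrite /g scale0r add0r.
have [_] := derive1_at_min le_e dg g0 gmin.
by rewrite /derive gE scale0r add0r.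
Qed.

End Derivatives.

(** * The rank-one matrices [psi x] and stationarity at a nearest point of the cone *)

Section Psi.
Context {R : realType}.
Implicit Types (x y v : 'cV[R]_3).

Lemma psiE x i j : psi x i j = (x 0 0)^-1 * (x i 0 * x j 0).
Proof. by rewrite !mxE big_ord1 mxE. Qed.

(** The derivative of [psi] at [x] in direction [v], by the product rule; meaningful only where
    [x 0 0] is nonzero. *)
Definition dpsi v x : 'M[R]_3 := \matrix_(i, j)
  ((x 0 0)^-1 * (v i 0 * x j 0 + x i 0 * v j 0)
   - (x 0 0) ^- 2 * v 0 0 * (x i 0 * x j 0)).

Lemma is_derive_psi x v i j : x 0 0 != 0 ->
  is_derive x v (fun y => psi y i j) (dpsi v x i j).
Proof.
move=> x0.
have -> : (fun y => psi y i j) =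
    (fun y => (y 0 0)^-1) * ((fun y => y i 0) * (fun y => y j 0)).
  by apply/funext => y; rewrite psiE.
have dc k := @is_derive_coord R 3 k x v.
have dinv := is_derive_inv x0 (dc 0).
apply: is_derive_eq.
rewrite mxE /GRing.scale /= -[X in _ + X * _ = _]/(x i 0 * x j 0); ring.
Qed.

Lemma is_derive_psiB x v A i j : x 0 0 != 0 ->
  is_derive x v (fun y => (psi y - A) i j) (dpsi v x i j).
Proof.
move=> x0; have dij := is_derive_psi v i j x0.
have -> : (fun y => (psi y - A) i j) = (fun y => psi y i j) - cst (A i j).
  by apply/funext => y; rewrite mxE [X in _ + X]mxE.
by apply: is_derive_eq; rewrite subr0.
Qed.

Lemma partial_psi x k : x 0 0 != 0 -> partial_mx k psi x = dpsi (delta_mx k 0) x.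
Proof.
move=> x0; apply/matrixP => i j; rewrite mxE /partial.
by have [_ ->] := is_derive_psi (delta_mx k 0) i j x0.
Qed.

(** This recovers [x] from [psi x], so that closeness of matrices gives closeness of parameters. *)
Lemma psi_col0 x i : x 0 0 != 0 -> psi x i 0 = x i 0.
Proof. by move=> x0; rewrite psiE mulrCA mulVf // mulr1. Qed.

Lemma psd_psi x : 0 < x 0 0 -> psd_cone (psi x).
Proof.
move=> x0; split.
  apply/is_hermitianmxP/matrixP => i j; rewrite expr0 scale1r [RHS]mxE [X in idfun X]mxE /=.
  by rewrite !psiE [x i 0 * _]mulrC.
move=> v; rewrite /psi -scalemxAr -scalemxAl mxE mulr_ge0 ?invr_ge0 ?(ltW x0) //.
(* The quadratic form of [x *m x^T] at [v] is the square of the scalar [v^T *m x]. *)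
rewrite (mulmxA v^T) -(mulmxA (v^T *m x)) mxE big_ord1.
have -> : x^T *m v = (v^T *m x)^T by rewrite trmx_mul trmxK.
by rewrite [_^T 0 0]mxE -expr2 sqr_ge0.
Qed.

(** Testing the quadratic form on the first basis vector yields the corner entry of [psi x], which
    is [x 0 0]. *)
Lemma psd_psi_gt0 x : x 0 0 != 0 -> psd_cone (psi x) -> 0 < x 0 0.
Proof.
move=> x0 [_ /(_ (delta_mx 0 0))].
rewrite trmx_delta -rowE -colE !mxE big_ord1 mxE mulrA mulVf // mul1r.
by rewrite lt_def x0.
Qed.

(** Rules out the default value 0 of [proj] when the projection equals [psi x]. *)
Lemma psi_neq0 x : x 0 0 != 0 -> psi x != 0.
Proof.
move=> x0; apply/eqP => /matrixP/(_ 0 0).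
by rewrite psi_col0 // mxE; apply/eqP.
Qed.

Lemma psi_nearest_stationary x A k : x 0 0 != 0 ->
  nearest_point psd_cone A (psi x) ->
  frob_inner (partial_mx k psi x) (psi x - A) = 0.
Proof.
move=> x0 [psdx minx]; set v : 'cV[R]_3 := delta_mx k 0.
have xgt0 := psd_psi_gt0 x0 psdx.
pose f y := frob_inner (psi y - A) (psi y - A).
have df y : y 0 0 != 0 ->
    is_derive y v f
      (frob_inner (dpsi v y) (psi y - A) + frob_inner (psi y - A) (dpsi v y)).
  move=> y0.
  have dpsiA i j := is_derive_psiB v A i j y0.
  exact: (is_derive_frob_inner dpsiA dpsiA).
(* Moving along a basis vector changes the first coordinate by [t] or not at all, so for |t| <
   [x 0 0] the line stays where [psi] takes values in the cone. *)
have pos t : t \in `]- x 0 0, x 0 0[%R -> 0 < (t *: v + x) 0 0.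
  rewrite in_itv /= !mxE eqxx andbT => /andP[tl tr].
  by case: (0 == k); rewrite ?mulr1 ?mulr0; lra.
have [_] := df x x0.
rewrite (derive_line_min xgt0) => [|t tI|t tI].
- rewrite [X in _ + X]frob_innerC partial_psi // => /esym/eqP.
  by rewrite -mulr2n mulrn_eq0 => /eqP.
- by have [] := df (t *: v + x) (lt0r_neq0 (pos _ tI)).
- have := minx _ (psd_psi (pos _ tI)).
  by rewrite ler_frob_norm /f !(frob_inner_distC A).
Qed.

End Psi.

(** * Orthogonal projection onto the plane [E] and the gradient of the squared distance *)

Section Plane.
Context {R : realType}.
Variables (E : set 'M[R]_3) (B : 3.-tuple 'M[R]_3).
Hypothesis E_psd : E `&` psd_cone = [set Ustar].
Hypothesis B_basis : orthogonal_basis (translate E Ustar) B.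
Implicit Types (A : 'M[R]_3) (p x : 'cV[R]_3).

(** The squared norm; since the basis is only orthogonal, it appears as a denominator in the
    coordinates of a projection. *)
Definition normB i := frob_inner (tnth B i) (tnth B i).

Lemma normB_neq0 i : normB i != 0.
Proof.
have [[V [_ bV]] _] := B_basis.
by rewrite frob_inner_eq0 (basis_not0 bV) ?mem_tnth.
Qed.

Lemma phi_plane p : E (phi B p).
Proof.
have [[V [EV bV]] _] := B_basis.
suff : translate E Ustar (\sum_(i < 3) p i 0 *: tnth B i).
  by case=> X EX /eqP; rewrite subr_eq addrC => /eqP XE; rewrite /phi -XE.
rewrite EV /=; apply: memv_suml => i _.
by rewrite memvZ // (basis_mem bV) ?mem_tnth.
Qed.

Lemma plane_phi A : E A -> exists p, A = phi B p.
Proof.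
have [[V [EV bV]] _] := B_basis.
move=> EA; have : translate E Ustar (A - Ustar) by exists A.
rewrite EV => /(coord_basis bV) AE.
exists (\col_i coord B i (A - Ustar)).
rewrite /phi -[LHS](subrK Ustar) addrC {1}AE; congr (_ + _).
by apply: eq_bigr => i _; rewrite mxE (tnth_nth 0).
Qed.

Lemma frob_inner_phi A p q :
  frob_inner A (phi B p - phi B q) = \sum_i (p - q) i 0 * frob_inner A (tnth B i).
Proof.
rewrite /phi opprD addrACA subrr add0r -sumrB frob_inner_sumr; apply: eq_bigr => i _.
by rewrite -scalerBl frob_innerZr !mxE.
Qed.

Lemma frob_inner_basis_phi i p q :
  frob_inner (tnth B i) (phi B p - phi B q) = (p - q) i 0 * normB i.
Proof.
have [_ orthB] := B_basis.
rewrite frob_inner_phi (bigD1 i) //= big1 ?addr0 // => j ji.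
by rewrite orthB ?mulr0 // eq_sym.
Qed.

Lemma sqr_phi p q : frob_inner (phi B p - phi B q) (phi B p - phi B q) =
  \sum_i (p - q) i 0 ^+ 2 * normB i.
Proof.
rewrite frob_inner_phi; apply: eq_bigr => i _.
by rewrite frob_innerC frob_inner_basis_phi mulrA expr2.
Qed.

Lemma phi0 : phi B 0 = Ustar.
Proof. by rewrite /phi big1 ?addr0 // => i _; rewrite mxE scale0r. Qed.

(** The Fourier coefficients of [A - Ustar], that is, the coordinates of the orthogonal projection
    of [A] onto [E]. *)
Definition foot A : 'cV[R]_3 := \col_i (frob_inner (A - Ustar) (tnth B i) / normB i).

Lemma foot_orth A p q : frob_inner (A - phi B (foot A)) (phi B p - phi B q) = 0.
Proof.
rewrite frob_inner_phi big1 // => i _.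
have -> : A - phi B (foot A) = (A - Ustar) - (phi B (foot A) - phi B 0).
  by rewrite phi0 opprB addrA subrK.
rewrite frob_innerBl (frob_innerC (phi B _ - _)) frob_inner_basis_phi subr0 [foot A i 0]mxE.
by rewrite divfK ?normB_neq0 // subrr mulr0.
Qed.

Lemma foot_pythagoras A p : frob_inner (A - phi B p) (A - phi B p) =
  frob_inner (A - phi B (foot A)) (A - phi B (foot A))
  + frob_inner (phi B (foot A) - phi B p) (phi B (foot A) - phi B p).
Proof.
have -> : A - phi B p = (A - phi B (foot A)) + (phi B (foot A) - phi B p).
  by rewrite addrA subrK.
have orth := foot_orth A (foot A) p.
move: (A - phi B (foot A)) (phi B (foot A) - phi B p) orth => X Y XY0.
by rewrite frob_innerDl !frob_innerDr (frob_innerC Y) XY0 addr0 add0r.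
Qed.

Lemma foot_nearest A : nearest_point E A (phi B (foot A)).
Proof.
split=> [|_ /plane_phi[p ->]]; first exact: phi_plane.
by rewrite ler_frob_norm (foot_pythagoras A p) lerDl frob_inner_ge0.
Qed.

(** Comparing [X] with the foot, Pythagoras leaves no room for a positive squared distance between
    them. *)
Lemma nearest_plane_unique A X : nearest_point E A X -> X = phi B (foot A).
Proof.
move=> [/plane_phi[p ->] /(_ _ (phi_plane (foot A)))].
rewrite ler_frob_norm (foot_pythagoras A p) gerDl => le0.
apply/esym/eqP; rewrite -subr_eq0 -frob_inner_eq0.
by rewrite eq_le le0 frob_inner_ge0.
Qed.

(** The zero matrix is in the cone, so if it lay in [E] it would equal [Ustar]. Hence a value of
    [proj] lying in [E] is not the default. *)
Lemma plane_neq0 A : E A -> A != 0.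
Proof.
move=> EA; apply/eqP => A0; move: EA; rewrite A0 => E0.
have : (E `&` psd_cone) 0.
  split=> //; split; last by move=> v; rewrite mulmx0 mul0mx mxE.
  by apply/is_hermitianmxP; rewrite trmx0 map_mx0 scaler0.
rewrite E_psd => /= /matrixP/(_ 0 0) /eqP.
by rewrite !mxE eqxx eq_sym oner_eq0.
Qed.

(* Pythagoras gives a formula for the distance that is polynomial in [psi x]. *)
Lemma half_sqdistE x : half_sqdist E x = 2^-1 *
  (frob_inner (psi x - Ustar) (psi x - Ustar)
   - \sum_i frob_inner (psi x - Ustar) (tnth B i) ^+ 2 / normB i).
Proof.
rewrite /half_sqdist (dist_nearest (foot_nearest _)) sqr_frob_norm; congr (_ * _).
have := foot_pythagoras (psi x) 0; rewrite sqr_phi phi0 => ->.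
apply/esym/eqP; rewrite subr_eq; apply/eqP; congr (_ + _); apply: eq_bigr => i _.
rewrite subr0 [foot _ i 0]mxE expr_div_n -mulrA; congr (_ * _).
by rewrite expr2 invfM -mulrA mulVf ?mulr1 ?normB_neq0.
Qed.

Lemma gradient_half_sqdist x k : x 0 0 != 0 ->
  gradient (half_sqdist E) x k 0 =
  frob_inner (partial_mx k psi x) (psi x - phi B (foot (psi x))).
Proof.
move=> x0; set v : 'cV[R]_3 := delta_mx k 0; rewrite partial_psi // mxE /partial -/v.
have dW i j := is_derive_psiB v Ustar i j x0.
have dC (X : 'M[R]_3) i j : is_derive x v (fun=> X i j) ((0 : 'M[R]_3) i j).
  by rewrite mxE; exact: is_derive_cst.
have dWW := is_derive_frob_inner dW dW.
have dWB i := is_derive_frob_inner dW (dC (tnth B i)).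
(* The distance formula is recast as a combination of functions, so that the derivative rules apply
   term by term. *)
have -> : half_sqdist E = 2^-1 \*:
    ((fun y => frob_inner (psi y - Ustar) (psi y - Ustar))
     - \sum_i (normB i)^-1 \*: ((fun y => frob_inner (psi y - Ustar) (tnth B i)) ^+ 2)).
  apply/funext => y; rewrite half_sqdistE.
  rewrite [RHS]/= fctE /= fct_sumE; congr (_ * (_ - _)).
  by apply: eq_bigr => i _; rewrite [RHS]/= mulrC.
have [_ ->] := is_deriveZ (2^-1) (is_deriveB dWW
  (is_derive_sum (fun i => is_deriveZ (normB i)^-1 (is_deriveX 2 (dWB i))))).
(* Expanding the foot around [Ustar] in the basis produces the same Fourier coefficients as
   differentiating the squared ones. *)
have -> : psi x - phi B (foot (psi x)) =
    (psi x - Ustar) - (phi B (foot (psi x)) - phi B 0).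
  by rewrite phi0 opprB addrA subrK.
rewrite (frob_innerBr _ (psi x - Ustar)) frob_inner_phi subr0 (frob_innerC _ (dpsi v x)) scalerBr.
rewrite scaler_sumr; congr (_ - _); first by rewrite /GRing.scale /=; lra.
apply: eq_bigr => i _; rewrite [foot _ i 0]mxE /frob_inner mulmx0 linear0 addr0 expr1.
by rewrite /GRing.scale /=; field; exact: normB_neq0.
Qed.

(** * One projection step: the gradient identity and the closeness of [x] to [xstar] *)

Lemma step_gradient p pt x : projection_step E B p pt x ->
  Mmat B x *m (pt - p) + gradient (half_sqdist E) x = 0.
Proof.
move=> [_ x0 projC projE].
have nearC : nearest_point psd_cone (phi B p) (psi x).
  by rewrite -projC; apply: proj_nearest; rewrite projC psi_neq0.
have nearE : nearest_point E (psi x) (phi B pt).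
  rewrite -projE; apply: proj_nearest; rewrite projE plane_neq0 //.
  exact: phi_plane.
apply/matrixP => k j; rewrite (ord1 j) mxE gradient_half_sqdist //.
rewrite -(nearest_plane_unique nearE) [RHS]mxE.
rewrite -[RHS](psi_nearest_stationary k x0 nearC).
have -> : psi x - phi B p = (phi B pt - phi B p) + (psi x - phi B pt).
  by rewrite [RHS]addrC addrA subrK.
rewrite [RHS]frob_innerDr frob_inner_phi mxE; congr (_ + _).
by apply: eq_bigr => i _; rewrite mxE mulrC.
Qed.

(* [Ustar] competes with [psi x] as a nearest point of the cone, so that
   |psi x - Ustar| <= 2 |phi p - Ustar|, and [x] is the first column of [psi x]. *)
Lemma step_close p pt x i : projection_step E B p pt x ->
  (x i 0 - xstar i 0) ^+ 2 <= 4 * \sum_j p j 0 ^+ 2 * normB j.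
Proof.
move=> [_ x0 projC _].
have [_ /(_ Ustar)] : nearest_point psd_cone (phi B p) (psi x).
  by rewrite -projC; apply: proj_nearest; rewrite projC psi_neq0.
have UC : psd_cone (@Ustar R) by have [] : (E `&` psd_cone) Ustar by rewrite E_psd.
move=> /(_ UC); rewrite ler_frob_norm => leU.
have := sqr_phi p 0; rewrite subr0 phi0 => <-.
have -> : x i 0 - xstar i 0 = (psi x - Ustar) i 0.
  by rewrite [RHS]mxE psi_col0 // !mxE.
apply: le_trans (le_frob_inner_entry _ _ _) _.
have -> : psi x - Ustar = (phi B p - Ustar) - (phi B p - psi x).
  by rewrite opprB [RHS]addrC addrA subrK.
move: (phi B p - Ustar) (phi B p - psi x) leU => X Y leYX.
(* The parallelogram law gives |X - Y|^2 <= 2|X|^2 + 2|Y|^2, and |Y| <= |X| turns this into the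
   constant 4. *)
have := frob_inner_ge0 (X + Y).
rewrite !(frob_innerBl, frob_innerBr, frob_innerDl, frob_innerDr).
by rewrite (frob_innerC Y X); lra.
Qed.

(** * Limits used for the local statement *)

Lemma cvg_det_dpsi (F : set_system 'cV[R]_3) (FF : Filter F) (y : 'cV[R]_3) :
  y 0 0 != 0 -> (forall i, (fun z : 'cV[R]_3 => z i 0) @ F --> y i 0) ->
  let N z : 'M[R]_3 :=
    \matrix_(k, i) frob_inner (dpsi (delta_mx k 0) z) (tnth B i) in
  \det (N z) @[z --> F] --> \det (N y).
Proof.
move=> y0 coordF N.
have invF : (fun z : 'cV[R]_3 => (z 0 0)^-1) @ F --> (y 0 0)^-1.
  exact: (cvgV y0 (coordF 0)).
have cF (c : R) : c @[_ --> F] --> c by exact: cvg_cst.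
have dpsiF v i j : dpsi v z i j @[z --> F] --> dpsi v y i j.
  have dpsiE z : dpsi v z i j = (z 0 0)^-1 * (v i 0 * z j 0 + z i 0 * v j 0)
      - (z 0 0)^-1 * (z 0 0)^-1 * v 0 0 * (z i 0 * z j 0).
    by rewrite mxE -exprVn expr2.
  rewrite dpsiE (funext dpsiE).
  exact: (cvgB
    (cvgM invF (cvgD (cvgM (cF _) (coordF j)) (cvgM (coordF i) (cF _))))
    (cvgM (cvgM (cvgM invF invF) (cF _)) (cvgM (coordF i) (coordF j)))).
have NF k i : N z k i @[z --> F] --> N y k i.
  have NE z : N z k i = \sum_a \sum_b dpsi (delta_mx k 0) z a b * tnth B i a b.
    by rewrite mxE frob_innerE.
  rewrite NE (funext NE).
  apply: (cvg_big add_continuous) => a _; apply: (cvg_big add_continuous) => b _.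
  exact: (cvgM (dpsiF _ _ _) (cF _)).
(* By the Leibniz expansion the determinant is a polynomial in the entries, so entrywise limits
   suffice. *)
rewrite /determinant.
apply: (cvg_big add_continuous) => s _; apply: (cvgM (cF _)).
by apply: (cvg_big mul_continuous) => i _; exact: NF.
Qed.

Lemma det_Mmat_near (y : 'cV[R]_3) : y 0 0 != 0 -> \det (Mmat B y) != 0 ->
  \forall x \near y, \det (Mmat B x) != 0.
Proof.
move=> y0; pose N x : 'M[R]_3 :=
  \matrix_(k, i) frob_inner (dpsi (delta_mx k 0) x) (tnth B i).
(* [Mmat] is replaced by the explicit [N], whose limit is known; they are shown to agree where the
   first coordinate is nonzero, hence near [y]. *)
have MN x : x 0 0 != 0 -> Mmat B x = N x.
  by move=> x0; apply/matrixP => k i; rewrite !mxE partial_psi.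
rewrite MN // => det0.
have coordy i : (fun x : 'cV[R]_3 => x i 0) @ y --> y i 0.
  exact: coord_continuous.
have det_cvg : (fun x => \det (N x)) @ y --> \det (N y).
  exact: (cvg_det_dpsi (nbhs_filter y) y0 coordy).
have nbhs_neq0 (a : R) : a != 0 -> nbhs a [set b | b != 0].
  by move=> a0; apply: open_nbhs_nbhs; split=> //; exact: open_neq.
have near_x0 : \forall x \near y, (x : 'cV[R]_3) 0 0 != 0.
  exact: (coordy 0 _ (nbhs_neq0 _ y0)).
have near_det : \forall x \near y, \det (N x) != 0.
  exact: (det_cvg _ (nbhs_neq0 _ det0)).
near=> x.
have x0 : x 0 0 != 0 by near: x.
by rewrite MN //; near: x.
Unshelve. all: by end_near. Qed.

Lemma cvg_sum_sqr_normB (F : set_system 'cV[R]_3) (FF : Filter F) (y : 'cV[R]_3) :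
  (forall i, (fun z : 'cV[R]_3 => z i 0) @ F --> y i 0) ->
  (fun z : 'cV[R]_3 => \sum_j z j 0 ^+ 2 * normB j) @ F --> \sum_j y j 0 ^+ 2 * normB j.
Proof.
move=> coordF; apply: (cvg_big add_continuous) => j _.
exact: (cvgM (cvgM (coordF j) (coordF j)) (cvg_cst _)).
Qed.

End Plane.

Theorem theorem4p1 (R : realType) (E : set 'M[R]_3) (B : 3.-tuple 'M[R]_3)
    (E_symm : E `<=` symm_set)
    (E_plane : affine_subspace 3 E)
    (E_psd : E `&` psd_cone = [set Ustar])
    (B_basis : orthogonal_basis (translate E Ustar) B) :
  (forall p pt x : 'cV[R]_3, projection_step E B p pt x ->
     Mmat B x *m (pt - p) + gradient (half_sqdist E) x = 0) /\
  (\det (Mmat B xstar) != 0 ->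
     \forall p \near (0 : 'cV[R]_3),
       forall pt x : 'cV[R]_3, projection_step E B p pt x ->
         Mmat B x \in unitmx /\
         pt = p - invmx (Mmat B x) *m gradient (half_sqdist E) x).
Proof.
split=> [p pt x|det0]; first exact: step_gradient.
have xs0 : (@xstar R) 0 0 != 0 by rewrite mxE oner_eq0.
have /nbhs_ballP[e /= e0 near_det] := det_Mmat_near xs0 det0.
have sum_cvg :
    (fun p : 'cV[R]_3 => \sum_j p j 0 ^+ 2 * normB B j) @ (0 : 'cV[R]_3) -->
    \sum_j (0 : 'cV[R]_3) j 0 ^+ 2 * normB B j.
  by apply: (cvg_sum_sqr_normB (nbhs_filter _)) => i; exact: coord_continuous.
(* The threshold [e ^+ 2 / 4] absorbs the factor 4 of [step_close], leaving each coordinate of [x]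
   within [e] of that of [xstar]. *)
have near_small : \forall p \near (0 : 'cV[R]_3),
    \sum_j (p : 'cV[R]_3) j 0 ^+ 2 * normB B j < e ^+ 2 / 4.
  apply: (sum_cvg [set s | s < e ^+ 2 / 4]); apply: open_nbhs_nbhs.
  split; first exact: open_lt.
  by rewrite /= big1 ?divr_gt0 ?exprn_gt0 // => j _; rewrite mxE expr0n mul0r.
near=> p => pt x step.
have small : \sum_j p j 0 ^+ 2 * normB B j < e ^+ 2 / 4 by near: p.
have unitM : Mmat B x \in unitmx.
  rewrite unitmxE unitfE; apply: near_det; split=> // i j.
  (* Balls of column vectors are entrywise, so a bound on each squared coordinate is enough. *)
  rewrite (ord1 j) /ball /= distrC -(ltr_pXn2r (n := 2)) ?nnegrE ?(ltW e0) //.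
  rewrite real_normK ?num_real //.
  by apply: le_lt_trans (step_close E_psd B_basis i step) _; lra.
split=> //.
have := step_gradient E_psd B_basis step.
move/eqP; rewrite addr_eq0 => /eqP Mstep.
by rewrite -mulmxN -Mstep mulKmx // addrC subrK.
Unshelve. all: by end_near.
Qed.
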